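(* Let $R_a>0$, let $\Phi\in C_c^\infty(0,1)$, and set $\phi_0(x)=\phi_0(r)=\Phi(r/R_a)$ for $x\in\mathbb{R}^2$, where $r^2=x\cdot x$. Then $u=\big(-\partial_2\phi_0(r),\partial_1\phi_0(r),0\big)$ is a solution of the static two-dimensional Euler equations $$(u\cdot\nabla)u+\nabla P=0,\qquad \nabla\cdot u=0,$$ with the Dirichlet boundary condition $u|_{\partial B^2(r<R_a)}=0$. In particular, the number of solutions of the static two-dimensional Euler equations with this Dirichlet boundary condition is infinite.
   Context: Here $x=(x_1,x_2)\in\mathbb{R}^2$, $\partial_j=\partial_{x_j}$, $u$ is the velocity field (depending only on $x_1,x_2$, with zero third component), $P$ is the scalar pressure (an unknown of the equations), and $B^2(r<R_a)$ is the open disc of radius $R_a$ centered at the origin of $\mathbb{R}^2$. *)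

(* Defs.v *)
From HB Require Import structures.
From mathcomp Require Import all_boot all_order all_algebra.
From mathcomp Require Import all_classical all_reals all_analysis.

Set Implicit Arguments.
Unset Strict Implicit.
Unset Printing Implicit Defensive.

Import Order.TTheory GRing.Theory Num.Theory.
Import numFieldNormedType.Exports.

Local Open Scope classical_set_scope.
Local Open Scope ring_scope.

(* The norm `|x| of the library on 'rV[R]_2 is the sup norm; radius x is the
   Euclidean one. *)
Definition radius (R : realType) (x : 'rV[R]_2) : R :=
  Num.sqrt ((x *m x^T) 0 0).

Definition disc (R : realType) (Ra : R) : set 'rV[R]_2 :=
  [set x | radius x < Ra].

Definition boundary (T : topologicalType) (A : set T) : set T :=
  closure A `\` interior A.

Definition smooth (R : realType) (f : R -> R) : Prop :=
  forall (n : nat) (t : R), derivable (derive1n n f) t 1.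

Definition fun_support (R : realType) (f : R -> R) : set R :=
  closure [set t | f t != 0].

(* C_c^oo(0,1), each function being extended by 0 to the real line. *)
Definition Cc_infty01 (R : realType) (f : R -> R) : Prop :=
  [/\ smooth f, compact (fun_support f) & fun_support f `<=` `]0, 1[].

(* All fields depend on (x_1, x_2) only.  partial i is the i-th partial
   derivative in R^3 of such a field: its derivative along the third axis
   (i = ord_max) is 0. *)
Definition partial (R : realType) (V : normedModType R) (i : 'I_3)
    (f : 'rV[R]_2 -> V) (x : 'rV[R]_2) : V :=
  if unlift ord_max i is Some j then 'D_(delta_mx 0 j : 'rV[R]_2) f x else 0.

Definition C1_on (R : realType) (V : normedModType R) (D : set 'rV[R]_2)
    (f : 'rV[R]_2 -> V) : Prop :=
  forall (x : 'rV[R]_2) (j : 'I_2), D x ->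
    derivable f x (delta_mx 0 j) /\
    {for x, continuous ('D_(delta_mx 0 j : 'rV[R]_2) f)}.

Definition grad (R : realType) (P : 'rV[R]_2 -> R) (x : 'rV[R]_2) : 'rV[R]_3 :=
  \row_(i < 3) partial i P x.

Definition divergence (R : realType) (u : 'rV[R]_2 -> 'rV[R]_3)
    (x : 'rV[R]_2) : R :=
  \sum_(i < 3) partial i (fun y => u y 0 i) x.

Definition convection (R : realType) (u : 'rV[R]_2 -> 'rV[R]_3)
    (x : 'rV[R]_2) : 'rV[R]_3 :=
  \sum_(i < 3) u x 0 i *: partial i u x.

(* Classical solutions in the disc: the pressure, being an unknown of the
   equations, is existentially quantified.  The values of u and P outside the
   closed disc are irrelevant. *)
Definition static_euler_solution (R : realType) (Ra : R)
    (u : 'rV[R]_2 -> 'rV[R]_3) : Prop :=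
  [/\ C1_on (disc Ra) u,
      {within closure (disc Ra), continuous u},
      (forall x, closure (disc Ra) x -> u x 0 ord_max = 0),
      (exists P : 'rV[R]_2 -> R,
         C1_on (disc Ra) P /\
         forall x, disc Ra x ->
           convection u x + grad P x = 0 /\ divergence u x = 0) &
      (forall x, boundary (disc Ra) x -> u x = 0)].

Definition stream (R : realType) (Ra : R) (Phi : R -> R) (x : 'rV[R]_2) : R :=
  Phi (radius x / Ra).

(* Indices start at 0: partial 1 is d/dx_2 and partial 0 is d/dx_1. *)
Definition velocity (R : realType) (phi : 'rV[R]_2 -> R) (x : 'rV[R]_2) :
    'rV[R]_3 :=
  \row_(i < 3)
    [:: - partial 1 phi x;
        partial 0 phi x;
        0]`_i.

(* Main.v *)
Require Import Defs.
From mathcomp Require Import all_boot all_order all_algebra.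
From mathcomp Require Import all_classical all_reals all_analysis.
From mathcomp Require Import ring lra.

Import Order.TTheory GRing.Theory Num.Theory.
Import numFieldNormedType.Exports.

Local Open Scope classical_set_scope.
Local Open Scope ring_scope.

Set Implicit Arguments.
Unset Strict Implicit.
Unset Printing Implicit Defensive.

(* With s = |x|^2, every field u = h(s) (-x_2, x_1, 0) is a rotation along the
   circles centred at the origin: its divergence vanishes and its convection is
   the centripetal term - h(s)^2 (x_1, x_2, 0), the opposite of the gradient of
   half an antiderivative of h^2 evaluated at s.  Hence u is a solution as soon
   as h is C^1 and h(Ra^2) = 0.  For a stream function k(|x|), the profile is
   h(s) = k'(sqrt s) / sqrt s, which is C^1 because k vanishes near 0.  The
   profiles n (Ra^2 - s), n a natural number, give infinitely many solutions. *)

(** * Directional derivatives and row-valued maps *)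

(** Both sides have the same difference quotient. This turns directional derivatives into
    derivatives in one real variable, where the chain rule [is_derive1_comp] applies without Fréchet
    differentiability. *)
Lemma is_derive_line (R : numFieldType) (V W : normedModType R) (f : V -> W)
    (x v : V) (df : W) :
  is_derive x v f df <-> is_derive (0 : R) 1 (fun t : R => f (t *: v + x)) df.
Proof.
have E : 'D_v f x = 'D_1 (fun t : R => f (t *: v + x)) 0.
  rewrite /derive; set d := (fun t => _); set d' := (fun t => _).
  suff -> : d = d' by []; apply/funext => t.
  by rewrite /d /d' /= addr0 scale0r add0r [t%:A]mulr1.
split=> -[dfx <-]; split; rewrite ?E//.
  exact: (iffLR (derivable1P f x v)).
exact: (iffRL (derivable1P f x v)).
Qed.

Lemma is_derive_comp_directional (R : realType) (V : normedModType R)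
    (h : R -> R) (g : V -> R) (x v : V) (dh dg : R) :
  is_derive (g x) 1 h dh -> is_derive x v g dg ->
  is_derive x v (h \o g) (dh * dg).
Proof.
move=> hgx /is_derive_line gxv; apply/is_derive_line.
by apply: is_derive1_comp; rewrite /= scale0r add0r.
Qed.

Lemma is_derive_row (R : realType) (V : normedModType R) (n : nat)
    (f : V -> 'rV[R]_n) (x v : V) (df : 'rV[R]_n) :
  (forall i, is_derive x v (fun y => f y 0 i) (df 0 i)) -> is_derive x v f df.
Proof.
move=> fxv; have dfx : derivable f x v.
  by apply/derivable_mxP => i j; rewrite ord1; case: (fxv j).
split=> //; rewrite derive_mx//; apply/rowP => j; rewrite mxE.
by case: (fxv j).
Qed.

Lemma continuous_row (R : realType) (T : topologicalType) (n : nat)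
    (f : T -> 'rV[R]_n) (x : T) :
  (forall i, continuous_at x (fun y => f y 0 i)) ->
  {for x, continuous f}.
Proof.
move=> fx; apply/cvgrPdist_le => /= e e0; near=> y.
rewrite /Num.Def.normr/= mx_normrE (bigmax_le _ (ltW e0))//= => -[i j] _.
rewrite !mxE/= ord1; move: j; near: y; apply: filter_forall => /= j.
exact: ((cvgrPdist_le _ _).1 (fx j)).
Unshelve. all: by end_near. Qed.

(** * The squared norm and the disc *)

Definition sqnorm (R : realType) (x : 'rV[R]_2) : R := x 0 0 ^+ 2 + x 0 1 ^+ 2.

Lemma radiusE (R : realType) (x : 'rV[R]_2) : Defs.radius x = Num.sqrt (sqnorm x).
Proof.
rewrite /Defs.radius /sqnorm mxE big_ord_recl big_ord1 !mxE -!expr2.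
by congr (Num.sqrt (_ + x 0 _ ^+ 2)); apply/val_inj.
Qed.

Lemma sqnorm_ge0 (R : realType) (x : 'rV[R]_2) : 0 <= sqnorm x.
Proof. by rewrite addr_ge0 ?sqr_ge0. Qed.

Lemma is_derive_coord (R : realType) (n : nat) (i : 'I_n) (x v : 'rV[R]_n) :
  is_derive x v (fun y => y 0 i) (v 0 i).
Proof.
apply/is_derive_line; rewrite (_ : (fun _ => _) = (fun t => v 0 i * t + x 0 i)).
  by apply: is_derive_eq; rewrite addr0; apply: mulr1.
by apply/funext => t; rewrite !mxE mulrC.
Qed.

Lemma continuous_sqnorm (R : realType) : continuous (@sqnorm R).
Proof.
move=> x; have c i : {for x, continuous (fun y : 'rV[R]_2 => y 0 i ^+ 2)}.
  apply: (@continuous_comp _ _ _ (fun y : 'rV[R]_2 => y 0 i) (fun t => t ^+ 2)).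
    exact: coord_continuous.
  exact: exprn_continuous.
exact: (continuousD (c 0) (c 1)).
Qed.

Lemma is_derive_sqnorm (R : realType) (x v : 'rV[R]_2) :
  is_derive x v (@sqnorm R) (2 * (x 0 0 * v 0 0 + x 0 1 * v 0 1)).
Proof.
have d0 := is_derive_coord 0 x v; have d1 := is_derive_coord 1 x v.
have := is_deriveD (is_deriveX 2 d0) (is_deriveX 2 d1).
move=> /is_derive_eq; apply; rewrite /GRing.scale/=; ring.
Qed.

Lemma discE (R : realType) (Ra : R) : 0 < Ra ->
  disc Ra = [set x | sqnorm x < Ra ^+ 2].
Proof.
move=> Ra0; rewrite /disc; apply/seteqP; split=> x /=; rewrite radiusE.
  by rewrite -ltr_sqr ?nnegrE ?sqrtr_ge0 ?ltW// sqr_sqrtr ?sqnorm_ge0.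
by move=> xRa; rewrite -ltr_sqr ?nnegrE ?sqrtr_ge0 ?ltW// sqr_sqrtr ?sqnorm_ge0.
Qed.

Lemma closure_discE (R : realType) (Ra : R) (x : 'rV[R]_2) : 0 < Ra ->
  closure (disc Ra) x -> sqnorm x <= Ra ^+ 2.
Proof.
move=> Ra0; rewrite (discE Ra0) => Dx.
have cl : closed (@sqnorm R @^-1` [set y | y <= Ra ^+ 2]).
  by apply: closed_comp; [move=> y _; exact: continuous_sqnorm|exact: closed_le].
by apply: (cl x); move: x Dx; apply: closureS => y /= /ltW.
Qed.

Lemma open_disc (R : realType) (Ra : R) : 0 < Ra -> open (disc Ra).
Proof.
move=> Ra0; rewrite (discE Ra0).
apply: (@open_comp _ _ (@sqnorm R) [set y | y < Ra ^+ 2]); last exact: open_lt.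
by move=> y _; exact: continuous_sqnorm.
Qed.

Lemma boundary_discE (R : realType) (Ra : R) (x : 'rV[R]_2) : 0 < Ra ->
  boundary (disc Ra) x -> sqnorm x = Ra ^+ 2.
Proof.
move=> Ra0 [/(closure_discE Ra0) xle].
rewrite (interior_id _).1; last exact: open_disc.
rewrite (discE Ra0) /= => /negP; rewrite -leNgt => xge.
by apply/eqP; rewrite eq_le xle.
Qed.

(** * Rotational fields and their derivatives *)

Definition rotational (R : realType) (h : R -> R) (x : 'rV[R]_2) : 'rV[R]_3 :=
  \row_(i < 3) [:: - (x 0 1 * h (sqnorm x)); x 0 0 * h (sqnorm x); 0]`_i.

(** The derivative of [rotational h] at [x] along [v], with [dh] in the role of h'; [ds] is the
    derivative of [sqnorm] along [v]. The direction comes first so that fixing it leaves a field in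
    [x]. *)
Definition rotational_derive (R : realType) (h dh : R -> R)
    (v x : 'rV[R]_2) : 'rV[R]_3 :=
  let ds := 2 * (x 0 0 * v 0 0 + x 0 1 * v 0 1) in
  \row_(i < 3) [:: - (v 0 1 * h (sqnorm x) + x 0 1 * (dh (sqnorm x) * ds));
                   v 0 0 * h (sqnorm x) + x 0 0 * (dh (sqnorm x) * ds);
                   0]`_i.

Lemma ord3P (i : 'I_3) : [\/ i = 0, i = 1 | i = ord_max].
Proof.
by case: i => [[|[|[|//]]] i3]; [apply: Or31|apply: Or32|apply: Or33];
  apply/val_inj.
Qed.

Section Rotational.
Variables (R : realType) (h dh : R -> R).
Hypothesis hdh : forall s : R, is_derive s 1 h (dh s).

Lemma is_derive_coord_sqnorm (i : 'I_2) (x v : 'rV[R]_2) :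
  is_derive x v (fun y => y 0 i * h (sqnorm y))
    (v 0 i * h (sqnorm x) +
     x 0 i * (dh (sqnorm x) * (2 * (x 0 0 * v 0 0 + x 0 1 * v 0 1)))).
Proof.
have hs := is_derive_comp_directional (hdh _) (is_derive_sqnorm x v).
have := is_deriveM (is_derive_coord i x v) hs.
by move=> /is_derive_eq; apply; rewrite /GRing.scale/= addrC [h _ * _]mulrC.
Qed.

Lemma is_derive_rotational (x v : 'rV[R]_2) :
  is_derive x v (rotational h) (rotational_derive h dh v x).
Proof.
apply: is_derive_row => i; rewrite mxE.
under eq_fun do rewrite mxE.
have [->|->|->] /= := ord3P i.
- exact: is_deriveN (is_derive_coord_sqnorm 1 x v).
- exact: is_derive_coord_sqnorm 0 x v.
- exact: is_derive_cst.
Qed.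

Lemma continuous_rotational : continuous (rotational h).
Proof.
move=> x; apply: continuous_row => i.
under eq_fun do rewrite mxE.
have c j : {for x, continuous (fun y : 'rV[R]_2 => y 0 j * h (sqnorm y))}.
  apply: continuousM; first exact: coord_continuous.
  apply: (@continuous_comp _ _ _ (@sqnorm R) h); first exact: continuous_sqnorm.
  exact/differentiable_continuous/derivable1_diffP.
have [->|->|->] /= := ord3P i.
- exact: continuousN (c 1).
- exact: c 0.
- exact: cst_continuous.
Qed.

Lemma continuous_rotational_derive (v : 'rV[R]_2) : continuous dh ->
  continuous (rotational_derive h dh v).
Proof.
move=> cdh x; apply: continuous_row => i.
under eq_fun do rewrite mxE.
have ch : {for x, continuous (fun y : 'rV[R]_2 => h (sqnorm y))}.
  apply: (@continuous_comp _ _ _ (@sqnorm R) h); first exact: continuous_sqnorm.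
  exact/differentiable_continuous/derivable1_diffP.
have cd : {for x, continuous (fun y : 'rV[R]_2 => dh (sqnorm y))}.
  apply: (@continuous_comp _ _ _ (@sqnorm R) dh); last exact: cdh.
  exact: continuous_sqnorm.
have cx j : {for x, continuous (fun y : 'rV[R]_2 => y 0 j)}.
  exact: coord_continuous.
have ck (k : R) : {for x, continuous (fun y : 'rV[R]_2 => k)}.
  exact: cst_continuous.
have c j : {for x, continuous (fun y : 'rV[R]_2 => v 0 j * h (sqnorm y) +
    y 0 j * (dh (sqnorm y) * (2 * (y 0 0 * v 0 0 + y 0 1 * v 0 1))))}.
  apply: continuousD; first exact: continuousM.
  apply: continuousM => //; apply: continuousM => //; apply: continuousM => //.
  by apply: continuousD; exact: continuousM.
have [->|->|->] /= := ord3P i.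
- exact: continuousN (c 1).
- exact: c 0.
- exact: ck.
Qed.

End Rotational.

(** * Partial derivatives, the pressure and the Euler equations *)

Lemma partial0E (R : realType) (V : normedModType R) (f : 'rV[R]_2 -> V) x :
  partial 0 f x = 'D_(delta_mx 0 0) f x.
Proof.
rewrite /partial; case: unliftP => [j jE|//].
by have -> : j = 0 by apply/ord_inj; rewrite -(lift_max j) -jE.
Qed.

Lemma partial1E (R : realType) (V : normedModType R) (f : 'rV[R]_2 -> V) x :
  partial 1 f x = 'D_(delta_mx 0 1) f x.
Proof.
rewrite /partial; case: unliftP => [j jE|//].
by have -> : j = 1 by apply/ord_inj; rewrite -(lift_max j) -jE.
Qed.

Lemma partial_maxE (R : realType) (V : normedModType R) (f : 'rV[R]_2 -> V) x :
  partial ord_max f x = 0.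
Proof. by rewrite /partial unlift_none. Qed.

Lemma big_ord3 (V : nmodType) (F : 'I_3 -> V) :
  \sum_(i < 3) F i = F 0 + F 1 + F ord_max.
Proof.
rewrite !big_ord_recr big_ord0 /= add0r.
by congr (F _ + F _ + F _); apply/val_inj.
Qed.

(** A formula for the derivative valid at every point identifies ['D_v f] with [df v] as functions,
    so continuity carries over. *)
Lemma C1_on_is_derive (R : realType) (V : normedModType R)
    (D : set 'rV[R]_2) (f : 'rV[R]_2 -> V) (df : 'rV[R]_2 -> 'rV[R]_2 -> V) :
  (forall x v, is_derive x v f (df v x)) -> (forall v, continuous (df v)) ->
  C1_on D f.
Proof.
move=> fdf cdf x j _; split; first exact: ex_derive.
rewrite (_ : (fun _ => _) = df (delta_mx 0 j)); first exact: cdf.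
by apply/funext => y; rewrite derive_val.
Qed.

(* The base point -1 makes the antiderivative differentiable at 0 too. *)
Lemma ex_antiderivative_ge0 (R : realType) (f : R -> R) : continuous f ->
  exists F : R -> R, forall s : R, 0 <= s -> is_derive s 1 F (f s).
Proof.
move=> cf; exists (fun s => \int[lebesgue_measure]_(t in `[-1, s]) f t).
move=> s s0; have s1 : -1 < s by rewrite (lt_le_trans _ s0)// ltrN10.
have fi : lebesgue_measure.-integrable `[-1, s + 1] (EFin \o f).
  apply: continuous_compact_integrable; first exact: segment_compact.
  exact: continuous_subspaceT.
have [|dF FE] := continuous_FTC1_closed _ fi s1 (cf s); first by rewrite ltrDl.
by split=> //; rewrite -derive1E.
Qed.

Lemma rotational_solution (R : realType) (Ra : R) (h dh : R -> R) :
  0 < Ra -> (forall s : R, is_derive s 1 h (dh s)) -> continuous dh ->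
  h (Ra ^+ 2) = 0 -> static_euler_solution Ra (rotational h).
Proof.
move=> Ra0 hdh cdh hRa.
have uE := is_derive_rotational hdh.
have ch : continuous h.
  by move=> s; exact/differentiable_continuous/derivable1_diffP.
split.
- apply: (C1_on_is_derive (df := rotational_derive h dh)) => // v.
  exact: continuous_rotational_derive.
- exact/continuous_subspaceT/(continuous_rotational hdh).
- by move=> x _; rewrite mxE.
- have ch2 : continuous (fun s => h s ^+ 2).
    by move=> s; apply: continuousM; exact: ch.
  have [F FE] := ex_antiderivative_ge0 ch2.
  (* The derivative of the pressure along [v]: the factor 2 in the derivative of [sqnorm] cancels
     the one half in front of [F]. *)
  pose dP (v x : 'rV[R]_2) :=
    h (sqnorm x) ^+ 2 * (x 0 0 * v 0 0 + x 0 1 * v 0 1).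
  have PE x v : is_derive x v (fun y => 2^-1 * F (sqnorm y)) (dP v x).
    have := is_deriveZ 2^-1 (is_derive_comp_directional (FE _ (sqnorm_ge0 x))
      (is_derive_sqnorm x v)).
    move=> /is_derive_eq; apply; rewrite /dP /GRing.scale/=.
    by field.
  exists (fun x => 2^-1 * F (sqnorm x)); split.
    apply: (C1_on_is_derive (df := dP)) => // v x.
    apply: (@continuousM _ _ (fun y => h (sqnorm y) ^+ 2)
      (fun y => y 0 0 * v 0 0 + y 0 1 * v 0 1)).
      apply: (@continuous_comp _ _ _ (@sqnorm R) (fun s => h s ^+ 2)); last exact: ch2.
      exact: continuous_sqnorm.
    apply: continuousD; (apply: continuousM; last exact: cst_continuous);
      exact: coord_continuous.
  move=> x _; split.
    (* The terms in [dh] cancel because [sqnorm] is constant along the flow; what remains of the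
       convection is minus h^2 times the position, opposite to the gradient given by [dP]. *)
    apply/rowP => i.
    rewrite /convection big_ord3 partial0E partial1E partial_maxE !mxE.
    rewrite !derive_val !mxE /=.
    have [->|->|->] /= := ord3P i; rewrite ?partial0E ?partial1E ?partial_maxE.
    + rewrite derive_val /dP !mxE /=; ring.
    + rewrite derive_val /dP !mxE /=; ring.
    + ring.
  rewrite /divergence big_ord3 partial0E partial1E partial_maxE addr0.
  have dE i v : 'D_v (fun y => rotational h y 0 i) x
      = rotational_derive h dh v x 0 i.
    have [dux duE] := uE x v; rewrite -duE derive_mx ?mxE//.
  rewrite !dE !mxE /=; ring.
- move=> x /(boundary_discE Ra0) xRa; apply/rowP => i.
  by rewrite !mxE xRa hRa !mulr0 oppr0; have [->|->|->] := ord3P i.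
Qed.

(** * Infinitely many solutions *)

Lemma infinite_static_euler_solutions (R : realType) (Ra : R) : 0 < Ra ->
  infinite_set [set u \_ (closure (disc Ra)) |
                 u in [set u | static_euler_solution Ra u]].
Proof.
move=> Ra0; pose u (n : nat) := rotational (fun s : R => n%:R * (Ra ^+ 2 - s)).
pose g n := u n \_ (closure (disc Ra)).
apply: (@sub_infinite_set _ [set g n | n in setT]).
  move=> _ [n _ <-]; exists (u n) => //=.
  apply: (@rotational_solution _ _ _ (fun=> - n%:R)) => //; last first.
  - by rewrite subrr mulr0.
  - by move=> s; exact: cst_continuous.
  - move=> s; apply: is_derive_eq; rewrite /GRing.scale/=; ring.
have ginj : injective g.
  (* At this point, inside the disc, the second component of [u n] is [n] times the nonzero constant
     [Ra / 2 * (Ra ^+ 2 - Ra ^+ 2 / 4)], hence determines [n]. *)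
  pose x : 'rV[R]_2 := (Ra / 2) *: delta_mx 0 0.
  move=> m n /(congr1 (fun w : 'rV[R]_2 -> 'rV[R]_3 => w x 0 1)).
  have sE : sqnorm x = Ra ^+ 2 / 4.
    by rewrite /sqnorm !mxE /= mulr1 mulr0; field.
  have xD : x \in closure (disc Ra).
    apply/mem_set/subset_closure; rewrite (discE Ra0) /= sE.
    have := exprn_gt0 2 Ra0; lra.
  rewrite /g !patchE xD.
  rewrite !mxE /= sE mulr1 => E; apply/eqP; rewrite -(eqr_nat R).
  apply/eqP.
  have c0 : Ra / 2 * (Ra ^+ 2 - Ra ^+ 2 / 4) != 0.
    rewrite mulf_neq0 ?gt_eqF ?divr_gt0//; have := exprn_gt0 2 Ra0; lra.
  by apply: (mulIf c0); move: E; rewrite !(mulrCA (Ra / 2)).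
move=> gfin; apply: infinite_nat.
rewrite (_ : setT = g @^-1` (g @` setT)); last first.
  by apply/seteqP; split=> // n _; exists n.
by apply: finite_preimage gfin => m n _ _; exact: ginj.
Qed.

(** * Division by the radius and composition with the square root *)

Section VanishingNearZero.
Variables (R : realType) (eps : R).
Hypothesis eps0 : 0 < eps.
Implicit Types f df : R -> R.

(** The whole half-line below [eps], negative numbers included, is covered: it is open, and every
    point outside it is positive, so division is regular there. *)
Let vanishing f := forall t, t < eps -> f t = 0.

Let near_vanishing f t : vanishing f -> t < eps -> \forall s \near t, 0 = f s.
Proof.
move=> f0 te; have : \forall s \near t, s < eps by exact: lt_nbhsl.
by apply: filterS => s /f0 ->.
Qed.

Lemma vanishing_is_derive f df :
  (forall t : R, is_derive t 1 f (df t)) -> vanishing f -> vanishing df.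
Proof.
move=> fdf f0 t te; have [_ <-] := fdf t.
rewrite -(near_eq_derive _ (near_vanishing f0 te)).
exact: derive_cst.
Qed.

(** From [eps] on this is the quotient rule; below, both sides are 0, at [t = 0] by the convention
    that the inverse of 0 is 0. The derivative is written through [f t / t] so that its numerator
    also vanishes below [eps] and can be divided by [t] again. *)
Lemma is_derive_div_id f df : (forall t : R, is_derive t 1 f (df t)) ->
  vanishing f ->
  forall t : R, is_derive t 1 (fun t => f t / t) ((df t - f t / t) / t).
Proof.
move=> fdf f0 t; have [te|et] := ltP t eps.
  have v : vanishing (fun t => f t / t) by move=> s /f0 ->; rewrite mul0r.
  rewrite (vanishing_is_derive fdf f0 te) (f0 _ te) mul0r subr0 mul0r.
  exact: near_eq_is_derive (near_vanishing v te) (is_derive_cst _ _ _).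
have t0 : t != 0 by rewrite gt_eqF// (lt_le_trans eps0).
have := is_deriveM (fdf t) (is_deriveV t0 (is_derive_id t 1)).
by move=> /is_derive_eq; apply; rewrite /GRing.scale/=; field.
Qed.

Lemma continuous_div_id f :
  continuous f -> vanishing f -> continuous (fun t => f t / t).
Proof.
move=> cf f0 t; have [te|et] := ltP t eps.
  have v : vanishing (fun t => f t / t) by move=> s /f0 ->; rewrite mul0r.
  apply: (near_cst_continuous 0); have := near_vanishing v te.
  by apply: filterS => s <-.
apply: continuousM; first exact: cf.
by apply: continuousV => //; rewrite gt_eqF// (lt_le_trans eps0).
Qed.

(** The square root is not differentiable at 0, but the composite is 0 for all [s < eps ^+ 2]. For
    [s <= 0] the stated derivative is 0 as well, since [Num.sqrt s] and its inverse are then 0. *)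
Lemma is_derive_comp_sqrt f df : (forall t : R, is_derive t 1 f (df t)) ->
  vanishing f ->
  forall s : R, is_derive s 1 (fun s => f (Num.sqrt s))
    (df (Num.sqrt s) / Num.sqrt s / 2).
Proof.
move=> fdf f0 s; have [s0|s0] := ltP 0 s.
  have := is_derive1_comp (fdf (Num.sqrt s)) (is_derive1_sqrt s0).
  move=> /is_derive_eq; apply; have r0 : Num.sqrt s != 0.
    by rewrite gt_eqF// sqrtr_gt0.
  by field.
rewrite (ler0_sqrtr s0) invr0 mulr0 mul0r.
apply: near_eq_is_derive (is_derive_cst 0 _ _).
have : \forall r \near s, r < eps ^+ 2.
  by apply: lt_nbhsl; rewrite (le_lt_trans s0)// exprn_gt0.
apply: filterS => r re; rewrite f0//.
by rewrite -(ger0_norm (ltW eps0)) -sqrtr_sqr ltr_sqrt ?exprn_gt0.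
Qed.

End VanishingNearZero.

(** * Stream functions *)

(** The support is closed and misses 0, hence misses a ball around 0; it contains no negative number
    either. *)
Lemma Cc_infty01_vanishing (R : realType) (Phi : R -> R) : Cc_infty01 Phi ->
  exists2 eps : R, 0 < eps & forall t, t < eps -> Phi t = 0.
Proof.
move=> [_ _ sub].
have out t : ~ fun_support Phi t -> Phi t = 0.
  by move=> tn; apply/eqP/negPn/negP => ?; apply/tn/subset_closure.
have : \forall t \near (0 : R), (~` fun_support Phi) t.
  apply: open_nbhs_nbhs; split; first exact/closed_openC/closed_closure.
  by move=> /sub; rewrite /= in_itv/= ltxx.
move=> /nbhs_ballP[e /= e0 eP]; exists e => // t te; apply: out.
have [t0|t0] := leP t 0; first by move=> /sub; rewrite /= in_itv/= ltNge t0.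
by apply: eP; rewrite /ball/= sub0r normrN gtr0_norm.
Qed.

(** The closed support misses 1, so [Phi] is 0 around 1. This yields the boundary condition, since
    the circle of radius [Ra] corresponds to the argument 1. *)
Lemma Cc_infty01_derive1 (R : realType) (Phi : R -> R) : Cc_infty01 Phi ->
  Phi^`()%classic 1 = 0.
Proof.
move=> [_ _ sub]; rewrite derive1E.
rewrite (@near_eq_derive _ _ _ _ (cst 0)); first exact: derive_cst.
have : \forall t \near (1 : R), (~` fun_support Phi) t.
  apply: open_nbhs_nbhs; split; first exact/closed_openC/closed_closure.
  by move=> /sub; rewrite /= in_itv/= ltxx andbF.
apply: filterS => t tn; apply/eqP/negPn/negP => ?; exact/tn/subset_closure.
Qed.

Lemma velocity_stream_rotational (R : realType) (Ra eps : R)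
    (Phi dk : R -> R) : 0 < eps ->
  (forall t : R, is_derive t 1 (fun t => Phi (t / Ra)) (dk t)) ->
  (forall t, t < eps -> Phi (t / Ra) = 0) ->
  velocity (stream Ra Phi) =
  rotational (fun s => dk (Num.sqrt s) / Num.sqrt s).
Proof.
move=> eps0 kdk k0; have sE : stream Ra Phi =
    (fun s => Phi (Num.sqrt s / Ra)) \o @sqnorm R.
  by apply/funext => x; rewrite /stream radiusE.
have D v x := is_derive_comp_directional
  (is_derive_comp_sqrt eps0 kdk k0 (sqnorm x)) (is_derive_sqnorm x v).
apply/funext => x; apply/rowP => i; rewrite !mxE partial0E partial1E sE.
rewrite !(@derive_val _ _ _ _ _ _ _ (D _ _)) !mxE /=.
set q := dk _ / _.
by have [->|->|->] := ord3P i => //=; field.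
Qed.

Lemma stream_solution (R : realType) (Ra : R) (Phi : R -> R) :
  0 < Ra -> Cc_infty01 Phi ->
  static_euler_solution Ra (velocity (stream Ra Phi)).
Proof.
move=> Ra0 PhiC; have [smPhi _ _] := PhiC.
have [e e0 Phi0] := Cc_infty01_vanishing PhiC.
have eRa0 : 0 < e * Ra by rewrite mulr_gt0.
have scale (f : R -> R) t : derivable f (t / Ra) 1 ->
    is_derive t 1 (fun t => f (t / Ra)) (f^`()%classic (t / Ra) / Ra).
  move=> df; rewrite derive1E; apply: is_derive1_comp; first exact: derivableP.
  by apply: is_derive_eq; rewrite /GRing.scale/=; ring.
(* First and second derivatives of the radial profile k(t) = Phi(t / Ra). *)
pose dk t := Phi^`()%classic (t / Ra) / Ra.
pose ddk t := Phi^`()%classic^`()%classic (t / Ra) / Ra / Ra.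
have kdk (t : R) : is_derive t 1 (fun t => Phi (t / Ra)) (dk t).
  exact: scale (smPhi 0%N _).
have dkddk (t : R) : is_derive t 1 dk (ddk t).
  have := is_deriveM (scale _ _ (smPhi 1%N (t / Ra))) (is_derive_cst Ra^-1 t 1).
  by move=> /is_derive_eq; apply; rewrite /ddk /GRing.scale/=; ring.
have k0 t : t < e * Ra -> Phi (t / Ra) = 0.
  by move=> te; apply: Phi0; rewrite ltr_pdivrMr.
have dk0 := vanishing_is_derive kdk k0.
have ddk0 := vanishing_is_derive dkddk dk0.
have cdk : continuous dk.
  by move=> t; exact/differentiable_continuous/derivable1_diffP.
have cddk : continuous ddk.
  (* Continuity of k'' comes from the existence of the third derivative of [Phi]. *)
  move=> t; apply/differentiable_continuous/derivable1_diffP.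
  apply: derivableM; last exact: derivable_cst.
  apply: derivableM; last exact: derivable_cst.
  by have [] := scale _ _ (smPhi 2%N (t / Ra)).
(* The angular velocity k'(t) / t as a function of the radius, and its derivative; the profile in s
   = |x|^2 is [h1] at [Num.sqrt s]. *)
pose h1 t := dk t / t.
pose dh1 t := (ddk t - h1 t) / t.
have h10 t : t < e * Ra -> h1 t = 0 by move=> /dk0 E; rewrite /h1 E mul0r.
have h1dh1 : forall t : R, is_derive t 1 h1 (dh1 t).
  by move=> t; exact: (is_derive_div_id eRa0 dkddk dk0).
have dh10 := vanishing_is_derive h1dh1 h10.
have cdh1 : continuous dh1.
  apply: (continuous_div_id eRa0); last first.
    by move=> t te; rewrite ddk0// h10// subr0.
  move=> t; apply: continuousB; first exact: cddk.
  exact: (continuous_div_id eRa0 cdk dk0).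
rewrite (velocity_stream_rotational eRa0 kdk k0).
have hdh := is_derive_comp_sqrt eRa0 h1dh1 h10.
apply: (rotational_solution Ra0 hdh).
  move=> s.
  apply: (@continuousM _ _ (fun s => dh1 (Num.sqrt s) / Num.sqrt s)
    (cst 2^-1)); last exact: cst_continuous.
  apply: (@continuous_comp _ _ _ (@Num.sqrt R) (fun t => dh1 t / t)).
    exact: sqrt_continuous.
  by have := continuous_div_id eRa0 cdh1 dh10; apply.
(* At s = Ra^2 the radius is [Ra], and k'(Ra) = Phi'(1) / Ra = 0. *)
rewrite /h1 sqrtr_sqr gtr0_norm// /dk divff ?gt_eqF//.
by rewrite Cc_infty01_derive1// !mul0r.
Qed.

(* Velocity fields are counted as functions on the closed disc, hence the
   restriction: fields differing only outside of it are the same solution. *)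
Theorem mainTheorem7 (R : realType) (Ra : R) (hRa : 0 < Ra) :
  (forall Phi : R -> R, Cc_infty01 Phi ->
     static_euler_solution Ra (velocity (stream Ra Phi))) /\
  infinite_set [set u \_ (closure (disc Ra)) |
                 u in [set u | static_euler_solution Ra u]].
Proof.
split=> [Phi|]; first exact: stream_solution.
exact: infinite_static_euler_solutions.
Qed.
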